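(* For any cubical abelian group $G$ with connections, $\pi_n(G)$ is naturally isomorphic to $H_n(N(G))$ for all $n\ge 0$.
   Context: A cubical object $X$ in a category is a family of objects $(X_n)_{n\ge0}$ with faces $\partial_i^0,\partial_i^1: X_n\to X_{n-1}$ and degeneracies $s_i: X_{n-1}\to X_n$ ($1\le i\le n$) such that $\partial_i^\alpha\partial_j^\varepsilon=\partial_{j-1}^\varepsilon\partial_i^\alpha$ for $i<j$; $s_is_j=s_{j+1}s_i$ for $i\le j$; and $\partial_i^\alpha s_j=s_{j-1}\partial_i^\alpha$ if $i<j$, $=\mathrm{id}$ if $i=j$, $=s_j\partial_{i-1}^\alpha$ if $i>j$ ($\alpha,\varepsilon\in\{0,1\}$). It has connections if there are given morphisms $\Gamma_i: X_n\to X_{n+1}$ ($1\le i\le n$) with: $\Gamma_i\Gamma_j=\Gamma_{j+1}\Gamma_i$ for $i\le j$; $\Gamma_is_j=s_{j+1}\Gamma_i$ if $i<j$, $=s_i^2$ if $i=j$, $=s_j\Gamma_{i-1}$ if $i>j$; $\partial_i^\alpha\Gamma_j=\Gamma_{j-1}\partial_i^\alpha$ if $i<j$; $\partial_i^0\Gamma_j=\mathrm{id}$ if $i=j,j+1$; $\partial_i^1\Gamma_j=s_j\partial_j^1$ if $i=j,j+1$; $\partial_i^\alpha\Gamma_j=\Gamma_j\partial_{i-1}^\alpha$ if $i>j+1$. A cubical abelian group with connections is a cubical object with connections in abelian groups; morphisms commute with faces, degeneracies and connections. A cubical set $X$ (cubical object in sets) is Kan if for any $n\ge1$, any $(i,\alpha)\in\{1,\dots,n\}\times\{0,1\}$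 and any $2n-1$ elements $x_j^\varepsilon\in X_{n-1}$ ($1\le j\le n$, $\varepsilon\in\{0,1\}$, $(j,\varepsilon)\ne(i,\alpha)$) with $\partial_j^\varepsilon x_k^\omega=\partial_{k-1}^\omega x_j^\varepsilon$ for $1\le j<k\le n$, $\varepsilon,\omega\in\{0,1\}$, $(j,\varepsilon),(k,\omega)\ne(i,\alpha)$, there is $x\in X_n$ with $\partial_j^\varepsilon x=x_j^\varepsilon$ for all $(j,\varepsilon)\neq(i,\alpha)$. By a known theorem of Tonks, any cubical group with connections is Kan, so that the homotopy groups below are defined. For a Kan cubical set $X$ with basepoint $\psi\in X_0$ (the degeneracies of $\psi$ in each $X_n$ are also denoted $\psi$), put $\widetilde X_0=X_0$ and, for $n>0$, $\widetilde X_n=\{x\in X_n: \partial_j^\varepsilon x=\psi \text{ for all } 1\le j\le n,\ \varepsilon\in\{0,1\}\}$. For $x,y\in\widetilde X_n$ write $x\sim y$ iff there is $z\in X_{n+1}$ with $\partial_1^0z=x$, $\partial_1^1z=y$ and $\partial_j^\varepsilon z=\psi$ for $2\le j\le n+1$, $\varepsilon\in\{0,1\}$; this is an equivalence relation. Set $\pi_n(X,\psi)=\widetilde X_n/\sim$. For $n\ge1$ it is a group under $[x]\bullet[y]=[\partial_1^1z]$, where $z\in X_{n+1}$ is any element (existing by the Kan condition) with $\partial_1^0z=x$, $\partial_2^0z=\psi$, $\partial_2^1z=y$ and $\partial_j^\varepsilon z=\psi$ for $3\le j\le n+1$, $\varepsilon\in\{0,1\}$; this depends only on the classes of $x$ and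 $y$. For a Kan cubical group $G$, $\pi_n(G)=\pi_n(G,1)$ with $1$ the unit of $G_0$ (for $n=0$, $\pi_0(G)$ is a quotient of the group $G_0$, with operation induced from $G_0$). $N(G)$ is the chain complex with $N_0(G)=G_0$, $N_n(G)=\bigcap_{i=1}^n\ker(\partial_i^1: G_n\to G_{n-1})$ for $n>0$, and differential $\partial=\sum_{i=1}^n(-1)^{i+1}\partial_i^0: N_n(G)\to N_{n-1}(G)$; $H_n(N(G))$ is its $n$-th homology group. *)

(* Defs.v *)
From HB Require Import structures.
From mathcomp Require Import all_boot all_order all_algebra.
From mathcomp Require Import boolp.

Set Implicit Arguments.
Unset Strict Implicit.
Unset Printing Implicit Defensive.

Import GRing.Theory.
Local Open Scope ring_scope.
Local Open Scope quotient_scope.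

(* Indices are 0-based: [d i a], [s i], [g i] with [i : 'I_n.+1] stand for   *)
(* $\partial_{i+1}^a$, $s_{i+1}$, $\Gamma_{i+1}$, and the superscripts 0, 1  *)
(* are the booleans [false], [true].  In the identities the indices are      *)
(* natural numbers i, j, and each bound is exactly the condition under which *)
(* every [inord] is applied to a number in the range of its target ordinal.  *)
Record cubical_axioms (X : nat -> Type)
    (d : forall n, 'I_n.+1 -> bool -> X n.+1 -> X n)
    (s : forall n, 'I_n.+1 -> X n -> X n.+1) : Prop := CubicalAxioms {
  face_face : forall n (i j : nat) a e (x : X n.+2), (i < j < n.+2)%N ->
    d n (inord i) a (d n.+1 (inord j) e x)
    = d n (inord j.-1) e (d n.+1 (inord i) a x);
  degen_degen : forall n (i j : nat) (x : X n), (i <= j < n.+1)%N ->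
    s n.+1 (inord i) (s n (inord j) x)
    = s n.+1 (inord j.+1) (s n (inord i) x);
  face_degen_lt : forall n (i j : nat) a (x : X n.+1), (i < j < n.+2)%N ->
    d n.+1 (inord i) a (s n.+1 (inord j) x)
    = s n (inord j.-1) (d n (inord i) a x);
  face_degen_eq : forall n (i : nat) a (x : X n), (i < n.+1)%N ->
    d n (inord i) a (s n (inord i) x) = x;
  face_degen_gt : forall n (i j : nat) a (x : X n.+1), (j < i < n.+2)%N ->
    d n.+1 (inord i) a (s n.+1 (inord j) x)
    = s n (inord j) (d n (inord i.-1) a x)
}.

Record connection_axioms (X : nat -> Type)
    (d : forall n, 'I_n.+1 -> bool -> X n.+1 -> X n)
    (s : forall n, 'I_n.+1 -> X n -> X n.+1)
    (g : forall n, 'I_n.+1 -> X n.+1 -> X n.+2) : Prop := ConnectionAxioms {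
  conn_conn : forall n (i j : nat) (x : X n.+1), (i <= j < n.+1)%N ->
    g n.+1 (inord i) (g n (inord j) x)
    = g n.+1 (inord j.+1) (g n (inord i) x);
  conn_degen_lt : forall n (i j : nat) (x : X n.+1), (i < j < n.+2)%N ->
    g n.+1 (inord i) (s n.+1 (inord j) x)
    = s n.+2 (inord j.+1) (g n (inord i) x);
  conn_degen_eq : forall n (i : nat) (x : X n), (i < n.+1)%N ->
    g n (inord i) (s n (inord i) x) = s n.+1 (inord i) (s n (inord i) x);
  conn_degen_gt : forall n (i j : nat) (x : X n.+1), (j < i < n.+2)%N ->
    g n.+1 (inord i) (s n.+1 (inord j) x)
    = s n.+2 (inord j) (g n (inord i.-1) x);
  face_conn_lt : forall n (i j : nat) a (x : X n.+2), (i < j < n.+2)%N ->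
    d n.+2 (inord i) a (g n.+1 (inord j) x)
    = g n (inord j.-1) (d n.+1 (inord i) a x);
  face0_conn : forall n (i j : nat) (x : X n.+1),
    (j < n.+1)%N -> i = j \/ i = j.+1 ->
    d n.+1 (inord i) false (g n (inord j) x) = x;
  face1_conn : forall n (i j : nat) (x : X n.+1),
    (j < n.+1)%N -> i = j \/ i = j.+1 ->
    d n.+1 (inord i) true (g n (inord j) x)
    = s n (inord j) (d n (inord j) true x);
  face_conn_gt : forall n (i j : nat) a (x : X n.+2), (j.+1 < i < n.+3)%N ->
    d n.+2 (inord i) a (g n.+1 (inord j) x)
    = g n (inord j) (d n.+1 (inord i.-1) a x)
}.

Record cubicalSet := CubicalSet {
  cell :> nat -> choiceType;
  face : forall n, 'I_n.+1 -> bool -> cell n.+1 -> cell n;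
  degen : forall n, 'I_n.+1 -> cell n -> cell n.+1;
  cubicalP : cubical_axioms face degen
}.

(* The value [x i a] at the missing face is irrelevant. *)
Definition open_box (X : cubicalSet) (n : nat) :
    'I_n.+1 -> bool -> ('I_n.+1 -> bool -> X n) -> Prop :=
  match n with
  | 0 => fun _ _ _ => True
  | m.+1 => fun i a x => forall (j k : 'I_m.+2) (e w : bool), (j < k)%N ->
      (j, e) != (i, a) -> (k, w) != (i, a) ->
      face (inord j) e (x k w) = face (inord k.-1) w (x j e)
  end.

Definition kan (X : cubicalSet) : Prop :=
  forall n (i : 'I_n.+1) (a : bool) (x : 'I_n.+1 -> bool -> X n),
    open_box i a x ->
    exists z : X n.+1, forall j e, (j, e) != (i, a) -> face j e z = x j e.

Record pointedKan := PointedKan {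
  kan_set :> cubicalSet;
  kanP : kan kan_set;
  base0 : kan_set 0%N
}.

Section HomotopyGroups.
Variable X : pointedKan.

Fixpoint base n : X n := if n is m.+1 then degen ord0 (base m) else base0 X.

Lemma degen_base n (i : 'I_n.+1) : degen i (base n) = base n.+1.
Proof.
elim: n i => [|n IHn] i; first by rewrite (ord1 i).
rewrite -[i]inord_val; case: (nat_of_ord i) (ltn_ord i) => [|j] ltj.
  by congr degen; apply: val_inj; rewrite /= inordK.
rewrite -[base n.+1]/(degen ord0 (base n)) -[ord0]inord_val.
rewrite -(degen_degen (cubicalP X)) ?IHn //=.
by congr degen; apply: val_inj; rewrite /= inordK.
Qed.

Lemma face_base n (i : 'I_n.+1) a : face i a (base n.+1) = base n.
Proof.
rewrite -(degen_base i) -[i]inord_val.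
by rewrite (face_degen_eq (cubicalP X)).
Qed.

Definition spherical n : pred (X n) :=
  match n with
  | 0 => predT
  | m.+1 => [pred x | [forall j, forall e, face j e x == base m]]
  end.

Definition sphere n := {x : X n | spherical x}.

Lemma sphericalP n (x : X n.+1) :
  reflect (forall j e, face j e x = base n) (spherical x).
Proof.
apply: (iffP forallP) => [h j e|h j]; first by move/forallP: (h j) => /(_ e)/eqP.
by apply/forallP => e; rewrite h.
Qed.

Lemma ord_neq0 n (i : 'I_n.+1) : (i != ord0) = (0 < i)%N.
Proof. by rewrite lt0n. Qed.

Definition homotopic n (x y : X n) : Prop :=
  exists z : X n.+1,
    [/\ face ord0 false z = x, face ord0 true z = y
      & forall j e, j != ord0 -> face j e z = base n].

Lemma inord0E n : inord 0 = ord0 :> 'I_n.+1.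
Proof. by apply: val_inj; rewrite /= inordK. Qed.

Lemma face_degen0 n (x : sphere n) (i : 'I_n.+1) e : (0 < i)%N ->
  face i e (degen ord0 (val x)) = base n.
Proof.
case: n x i => [|n] x i i_gt0; first by rewrite (ord1 i) in i_gt0.
rewrite -[i]inord_val -inord0E (face_degen_gt (cubicalP X)) ?i_gt0 ?ltn_ord //.
by rewrite (sphericalP _ (valP x)) inord0E.
Qed.

Lemma homotopic_refl n (x : sphere n) : homotopic (val x) (val x).
Proof.
exists (degen ord0 (val x)); split; last first.
- by move=> j e; rewrite ord_neq0; apply: face_degen0.
- by rewrite -inord0E (face_degen_eq (cubicalP X)).
- by rewrite -inord0E (face_degen_eq (cubicalP X)).
Qed.

Lemma face_face0 n (j : 'I_n.+1) a e (x : X n.+2) :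
  face j e (face ord0 a x) = face ord0 a (face (inord j.+1) e x).
Proof.
have := face_face (cubicalP X) a e x (ltn_ord j : (0 < j.+1 < n.+2)%N).
by rewrite !inord0E /= inord_val => ->.
Qed.

Lemma homotopic_eucl n (x : sphere n) (y v : X n) :
  homotopic (val x) y -> homotopic (val x) v -> homotopic y v.
Proof.
move=> [z [z0 z1 zj]] [w [w0 w1 wj]].
pose B (j : 'I_n.+2) e : X n.+1 :=
  match val j with
  | 0 => degen ord0 (val x)
  | 1 => if e then w else z
  | _ => base n.+1
  end.
have BP : open_box ord0 true B.
  move=> [j ltj] [k ltk] e o /= ltjk.
  rewrite /B; case: j ltj ltjk => [|[|j]] ltj ltjk /=.
  - case: e => // _ _; case: k ltk ltjk => [|[|k]] //= ltk _.
      rewrite !inord0E -[in RHS]inord0E (face_degen_eq (cubicalP X)) //.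
      by case: o.
    by rewrite face_base face_degen0 ?inordK.
  - case: k ltk ltjk => [|[|k]] //= ltk _ _ _; rewrite face_base.
    have k0 : (inord k.+1 : 'I_n.+1) != ord0 by rewrite ord_neq0 inordK.
    by case: e; rewrite ?zj ?wj.
  - by case: k ltk ltjk => [|[|k]] //= ltk _ _ _; rewrite !face_base.
have [f fP] := kanP BP.
have in1 : val (inord 1 : 'I_n.+2) = 1%N by rewrite /= inordK.
exists (face ord0 true f); split.
- rewrite face_face0 fP; first by rewrite /B in1.
  by rewrite xpair_eqE -val_eqE in1.
- rewrite face_face0 fP; first by rewrite /B in1.
  by rewrite xpair_eqE -val_eqE in1.
- move=> j e; rewrite ord_neq0 => j_gt0.
  have inj : val (inord j.+1 : 'I_n.+2) = j.+1 by rewrite /= inordK // ltnS.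
  rewrite face_face0 fP; last by rewrite xpair_eqE -val_eqE inj.
  by rewrite /B inj; case: (val j) j_gt0 => // m _; rewrite face_base.
Qed.

Definition sim n (x y : sphere n) : bool := `[< homotopic (val x) (val y) >].

Lemma sim_equiv n : equiv_class_of (@sim n).
Proof.
have simxx : reflexive (@sim n) by move=> x; apply/asboolP/homotopic_refl.
have eucl x y z : @sim n x y -> sim x z -> sim y z.
  by move=> /asboolP xy /asboolP xz; apply/asboolP/(homotopic_eucl xy xz).
have imp x y : sim x y -> @sim n y x by move=> xy; apply: eucl xy (simxx x).
split=> // [x y|y x z xy yz]; first by apply/idP/idP; apply: imp.
exact: eucl (imp _ _ xy) yz.
Qed.

Canonical sim_equivRel n := EquivRelPack (@sim_equiv n).

Definition homotopyGroup n := {eq_quot (@sim n)}.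

Lemma homotopyGroupP n (x y : sphere n) :
  \pi_(homotopyGroup n) x = \pi_(homotopyGroup n) y
  <-> homotopic (val x) (val y).
Proof. by split=> [/eqmodP/asboolP|h]; last by apply/eqmodP/asboolP. Qed.

Definition mul_filler n (x y : X n.+1) (z : X n.+2) : Prop :=
  [/\ face ord0 false z = x, face (inord 1) false z = base n.+1,
      face (inord 1) true z = y
    & forall (j : 'I_n.+2) e, (1 < j)%N -> face j e z = base n.+1].

Lemma mul_filler_exists n (x y : sphere n.+1) :
  exists z, mul_filler (val x) (val y) z.
Proof.
have [/sphericalP fx /sphericalP fy] := (valP x, valP y).
pose B (j : 'I_n.+2) e : X n.+1 :=
  match val j with
  | 0 => val x
  | 1 => if e then val y else base n.+1
  | _ => base n.+1
  end.
have BF j e i a : face i a (B j e) = base n.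
  by rewrite /B; case: (val j) => [|[|?]] //; rewrite ?face_base ?fx //;
    case: e; rewrite ?face_base ?fy.
have BP : open_box ord0 true B by move=> *; rewrite !BF.
have [z zP] := kanP BP.
have in1 : val (inord 1 : 'I_n.+2) = 1%N by rewrite /= inordK.
exists z; split.
- by rewrite zP.
- by rewrite zP /B ?in1 // xpair_eqE -val_eqE in1.
- by rewrite zP /B ?in1 // xpair_eqE -val_eqE in1.
- move=> [[|[|j]] ltj] e //= _; by rewrite zP.
Qed.

Lemma mul_filler_spherical n (x y : sphere n.+1) z :
  mul_filler (val x) (val y) z -> spherical (face ord0 true z).
Proof.
have /sphericalP fy := valP y.
move=> [z0 z10 z11 zj]; apply/sphericalP => j e; rewrite face_face0.
case: (posnP j) => [->|j_gt0]; first by case: e; rewrite ?z10 ?z11 ?face_base.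
by rewrite zj ?face_base // inordK ltnS.
Qed.

Lemma mul_filler_homotopic n (x x' y y' : X n.+1) z z' :
  homotopic x x' -> homotopic y y' -> mul_filler x y z -> mul_filler x' y' z' ->
  homotopic (face ord0 true z) (face ord0 true z').
Proof.
move=> [u [u0 u1 uj]] [v [v0 v1 vj]] [z0 z10 z11 zj] [z0' z10' z11' zj'].
pose B (j : 'I_n.+3) e : X n.+2 :=
  match val j with
  | 0 => if e then z' else z
  | 1 => u
  | 2 => if e then v else base n.+2
  | _ => base n.+2
  end.
have in1 m : val (inord 1 : 'I_m.+2) = 1%N by rewrite /= inordK.
have n10 : (inord 1 : 'I_n.+2) != ord0 by rewrite ord_neq0 in1.
have BP : open_box (inord 1) true B.
  move=> [j ltj] [k ltk] e o /= ltjk; rewrite !xpair_eqE -!val_eqE in1 /=.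
  rewrite /B /=; case: j ltj ltjk => [|[|j]] ltj ltjk /=.
  - move=> _; case: k ltk ltjk => [|[|[|k]]] //= ltk _; rewrite !inord0E.
    + by case: o => // _; case: e; rewrite ?u0 ?u1 ?z0 ?z0'.
    + by move=> _; case: o; case: e;
        rewrite ?v0 ?v1 ?z11 ?z11' ?z10 ?z10' ?face_base.
    + by move=> _; rewrite face_base; case: e; rewrite ?zj ?zj' // inordK.
  - case: e => // _; case: k ltk ltjk => [|[|[|k]]] //= ltk _ _.
      by rewrite uj //; case: o; rewrite ?vj ?face_base.
    by rewrite face_base uj // ord_neq0 inordK.
  - case: k ltk ltjk => [|[|[|k]]] //= ltk ltjk _ _.
    rewrite face_base; case: j ltj ltjk => [|j] ltj ltjk; last by rewrite face_base.
    by case: e; rewrite ?face_base // vj // ord_neq0 inordK.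
have [f fP] := kanP BP.
have ff (j : 'I_n.+2) e : (0 < j)%N ->
    face j e (face (inord 1) true f) = face (inord 1) true (face (inord j.+1) e f).
  move=> j0; rewrite (face_face (cubicalP X)) ?inord_val //.
  by rewrite ltnS j0 ltnS ltn_ord.
have f0 e : face ord0 e (face (inord 1) true f) = face ord0 true (face ord0 e f).
  by rewrite -!inord0E (face_face (cubicalP X)).
exists (face (inord 1) true f); split.
- by rewrite f0 fP // xpair_eqE -val_eqE in1.
- by rewrite f0 fP // xpair_eqE -val_eqE in1.
- move=> j e; rewrite ord_neq0 => j_gt0; rewrite ff //.
  have inj : val (inord j.+1 : 'I_n.+3) = j.+1 by rewrite /= inordK // ltnS.
  rewrite fP; last by rewrite xpair_eqE -val_eqE inj in1 eqSS -[_ == _]negbK -lt0n j_gt0.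
  rewrite /B inj; case: (val j) j_gt0 => // -[|m] _; last by rewrite face_base.
  by case: e; rewrite ?face_base ?vj.
Qed.

Definition mul_sphere n (x y : sphere n.+1) : sphere n.+1 :=
  let z := cid (mul_filler_exists x y) in
  exist _ (face ord0 true (projT1 z)) (mul_filler_spherical (projT2 z)).

(* The filler is an arbitrary choice; [homotopy_mulE] shows that every filler *)
(* of every pair of representatives gives the same class.                    *)
Definition homotopy_mul n (a b : homotopyGroup n.+1) : homotopyGroup n.+1 :=
  \pi_(homotopyGroup n.+1) (mul_sphere (repr a) (repr b)).

Lemma homotopy_mulE n (x y w : sphere n.+1) z :
  mul_filler (val x) (val y) z -> val w = face ord0 true z ->
  homotopy_mul (\pi_(homotopyGroup n.+1) x) (\pi_(homotopyGroup n.+1) y)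
  = \pi_(homotopyGroup n.+1) w.
Proof.
move=> zP wz; apply/homotopyGroupP; rewrite wz /=.
have hr (u : sphere n.+1) :
    homotopic (val (repr (\pi_(homotopyGroup n.+1) u))) (val u).
  by apply/homotopyGroupP; rewrite reprK.
by case: cid => z' z'P /=; apply: mul_filler_homotopic (hr x) (hr y) z'P zP.
Qed.

End HomotopyGroups.

Record pointedMap (X Y : pointedKan) := PointedMap {
  pmap :> forall n, X n -> Y n;
  pmap_face : forall n (i : 'I_n.+1) a (x : X n.+1),
    pmap (face i a x) = face i a (pmap x);
  pmap_degen : forall n (i : 'I_n.+1) (x : X n),
    pmap (degen i x) = degen i (pmap x);
  pmap_base0 : pmap (base0 X) = base0 Y
}.

Section HomotopyMap.
Variables (X Y : pointedKan) (f : pointedMap X Y).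

Lemma pmap_base n : f n (base X n) = base Y n.
Proof. by elim: n => [|n IHn]; rewrite /= ?pmap_base0 // pmap_degen IHn. Qed.

Lemma pmap_spherical n (x : sphere X n) : spherical (f n (val x)).
Proof.
case: n x => [//|n] x; apply/sphericalP => j e.
by rewrite -pmap_face (sphericalP _ (valP x)) pmap_base.
Qed.

Definition sphere_map n (x : sphere X n) : sphere Y n :=
  exist _ (f n (val x)) (pmap_spherical x).

Definition homotopy_map n (c : homotopyGroup X n) : homotopyGroup Y n :=
  \pi_(homotopyGroup Y n) (sphere_map (repr c)).

Lemma homotopy_mapE n (x : sphere X n) :
  homotopy_map (\pi_(homotopyGroup X n) x)
  = \pi_(homotopyGroup Y n) (sphere_map x).
Proof.
apply/homotopyGroupP => /=.
have /homotopyGroupP[z [z0 z1 zj]] := reprK (\pi_(homotopyGroup X n) x).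
exists (f n.+1 z); split; rewrite -?pmap_face ?z0 ?z1 // => j e j0.
by rewrite -pmap_face zj // pmap_base.
Qed.

End HomotopyMap.

Record cubicalAbGroup := CubicalAbGroup {
  grp :> nat -> zmodType;
  gface : forall n, 'I_n.+1 -> bool -> {additive grp n.+1 -> grp n};
  gdegen : forall n, 'I_n.+1 -> {additive grp n -> grp n.+1};
  gconn : forall n, 'I_n.+1 -> {additive grp n.+1 -> grp n.+2};
  gcubicalP : @cubical_axioms (fun n => grp n)
    (fun n i a => gface i a) (fun n i => gdegen i);
  gconnP : @connection_axioms (fun n => grp n)
    (fun n i a => gface i a) (fun n i => gdegen i) (fun n i => gconn i)
}.

Arguments gface {c n} i a.
Arguments gdegen {c n} i.
Arguments gconn {c n} i.

Record cubicalAbHom (G H : cubicalAbGroup) := CubicalAbHom {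
  ghom :> forall n, {additive G n -> H n};
  ghom_face : forall n (i : 'I_n.+1) a (x : G n.+1),
    ghom n (gface i a x) = gface i a (ghom n.+1 x);
  ghom_degen : forall n (i : 'I_n.+1) (x : G n),
    ghom n.+1 (gdegen i x) = gdegen i (ghom n x);
  ghom_conn : forall n (i : 'I_n.+1) (x : G n.+1),
    ghom n.+2 (gconn i x) = gconn i (ghom n.+1 x)
}.

Section Tonks.
Variable G : cubicalAbGroup.

Local Notation D i e x := (gface (inord i) e x).
Local Notation S i x := (gdegen (inord i) x).
Local Notation C i x := (gconn (inord i) x).

Let GP := gcubicalP G.
Let CP := gconnP G.

Lemma unbump_lt j k : (k < j)%N -> unbump j k = k.
Proof. by move=> ltkj; rewrite /unbump ltnNge (ltnW ltkj) subn0. Qed.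

Lemma unbump_gt j k : (j < k)%N -> unbump j k = k.-1.
Proof. by move=> ltjk; rewrite /unbump ltjk subn1. Qed.

Lemma face_degen_id m q e (y : G m) : (q < m.+1)%N -> D q e (S q y) = y.
Proof. exact: (face_degen_eq GP). Qed.

Lemma face_degen_eq0 m q k e (y : G m.+1) : (q < m.+2)%N -> (k < m.+2)%N ->
  k != q -> D (unbump q k) e y = 0 -> D k e (S q y) = 0.
Proof.
move=> ltq ltk; rewrite neq_ltn => /orP[h|h].
  by rewrite unbump_lt // (face_degen_lt GP) ?h // => ->; rewrite raddf0.
by rewrite unbump_gt // (face_degen_gt GP) ?h // => ->; rewrite raddf0.
Qed.

Lemma face_conn_eq0 m q k e (y : G m.+1) : (q < m.+1)%N -> (k < m.+2)%N ->
  k != q -> k != q.+1 -> D (unbump q k) e y = 0 -> D k e (C q y) = 0.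
Proof.
case: m y => [|m] y ltq ltk.
  by case: q ltq => // _; case: k ltk => [|[|]].
rewrite neq_ltn => /orP[h _|h k1].
  by rewrite unbump_lt // (face_conn_lt CP) ?h // => ->; rewrite raddf0.
have h1 : (q.+1 < k)%N by rewrite ltn_neqAle eq_sym k1.
by rewrite unbump_gt // (face_conn_gt CP) ?h1 // => ->; rewrite raddf0.
Qed.

Lemma face0_conn_id m q k (y : G m.+1) : (q < m.+1)%N -> k = q \/ k = q.+1 ->
  D k false (C q y) = y.
Proof. exact: (face0_conn CP). Qed.

Lemma face1_conn_eq0 m q k (y : G m.+1) : (q < m.+1)%N -> k = q \/ k = q.+1 ->
  D q true y = 0 -> D k true (C q y) = 0.
Proof. by move=> ltq kq y0; rewrite (face1_conn CP) // y0 raddf0. Qed.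

Definition fills m (i : nat) (a : bool) (j : nat) (b : bool) (y : G m.+1) :=
  exists z : G m.+2, [/\ D j b z = y, D j (~~ b) z = 0
    & forall k e, (k < m.+2)%N -> k != j -> (k, e) != (i, a) ->
        D (unbump j k) e y = 0 -> D k e z = 0].

Lemma fills_swap m i a j b (y : G m.+1) : (j < m.+2)%N ->
  fills i a j (~~ b) y -> fills i a j b y.
Proof.
move=> ltj [z [z1 z2 zP]]; rewrite negbK in z2; exists (S j y - z); split.
- by rewrite raddfB /= face_degen_id // z2 subr0.
- by rewrite raddfB /= face_degen_id // z1 subrr.
- move=> k e ltk kj ki yk.
  by rewrite raddfB /= (face_degen_eq0 ltj) // zP // subr0.
Qed.

Lemma fills_false m i a j (y : G m.+1) b : (j < m.+2)%N ->
  fills i a j false y -> fills i a j b y.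
Proof. by move=> ltj h; case: b => //; apply: fills_swap. Qed.

Lemma fill_lt m i a j b (y : G m.+1) : (j < i < m.+2)%N ->
  (forall k e, (j < k < i)%N -> D (unbump j k) e y = 0) ->
  D (unbump j i) (~~ a) y = 0 -> fills i a j b y.
Proof.
move def_d: (i - j.+1)%N => d; elim: d j b def_d => [|d IHd] j b def_d.
  move=> /andP[ltji lti] _.
  have def_i : i = j.+1.
    by apply/eqP; rewrite eqn_leq ltji -subn_eq0 def_d.
  have ltj : (j < m.+1)%N by rewrite -ltnS -def_i.
  rewrite unbump_gt // def_i /= => y0.
  apply: fills_false (ltnW _) _ => //.
  case: a y0 => /= y0.
    exists (C j y - S j.+1 y); split; rewrite ?raddfB /=.
    - rewrite face0_conn_id //; last by left.
      by rewrite face_degen_eq0 ?subr0 //; [exact: ltnW|rewrite neq_ltn leqnn|rewrite unbump_lt].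
    - rewrite (face1_conn CP) //; last by left.
      rewrite (face_degen_lt GP) ?leqnn //=.
      by rewrite subrr.
    - move=> k e ltk kj; case: (eqVneq k j.+1) => [->|kj1] ke yk; rewrite raddfB /=.
        case: e ke yk => [|_ yk]; first by rewrite eqxx.
        by rewrite face0_conn_id ?face_degen_id ?subrr //; right.
      rewrite face_conn_eq0 // face_degen_eq0 ?subrr //.
      move: yk; case: (ltngtP k j) kj => // [h|h] _.
        by rewrite !unbump_lt // (ltn_trans h).
      by rewrite !unbump_gt // ltn_neqAle eq_sym kj1.
  exists (C j y); split.
  - by rewrite face0_conn_id //; left.
  - by rewrite face1_conn_eq0 //; left.
  - move=> k e ltk kj; case: (eqVneq k j.+1) => [->|kj1] ke yk.
      case: e ke yk => [_ yk|]; last by rewrite eqxx.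
      by rewrite face1_conn_eq0 //; right.
    by rewrite face_conn_eq0.
move=> /andP[ltji lti] y0 yi.
have ltj1i : (j.+1 < i)%N by rewrite -subn_gt0 def_d.
have ltj1 : (j.+1 < m.+2)%N := ltn_trans ltj1i lti.
have yj e : D j e y = 0.
  by have := y0 j.+1 e; rewrite unbump_gt //= leqnn => ->.
have [||k e /andP[h1 h2]||z [z1 z2 zP]] := IHd j.+1 true.
- by rewrite subnS def_d.
- by rewrite ltj1i.
- rewrite unbump_gt // -(@unbump_gt j) ?y0 ?h2 ?(ltnW h1) //.
- by rewrite unbump_gt // -(@unbump_gt j).
apply: fills_false (ltnW _) _ => //.
have jj1 : j != j.+1 by rewrite neq_ltn leqnn.
have zj e : D j e z = 0.
  apply: zP => //; [exact: ltnW|by rewrite xpair_eqE (ltn_eqF ltji)|].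
  by rewrite unbump_lt.
have sj e : D j e (S j.+1 y) = 0.
  by rewrite face_degen_eq0 // ?unbump_lt //; exact: ltnW.
exists (C j y - S j.+1 y + z); split; rewrite ?(raddfD, raddfN) /= ?(raddfD, raddfN) /=.
- by rewrite face0_conn_id ?sj ?zj ?subr0 ?addr0 //; left.
- by rewrite face1_conn_eq0 ?sj ?zj ?subr0 ?addr0 //; left.
- move=> k e ltk kj ke yk; rewrite !(raddfD, raddfN) /=.
  case: (eqVneq k j.+1) => [->|kj1].
    rewrite face_degen_id //; case: e {ke yk}.
      by rewrite face1_conn_eq0 ?z1 ?sub0r ?addNr //; right.
    by rewrite face0_conn_id ?z2 ?subrr ?addr0 //; right.
  have yk' : D (unbump j.+1 k) e y = 0.
    move: yk; case: (ltngtP k j) kj => // [h|h] _.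
      by rewrite !unbump_lt // (ltn_trans h).
    by rewrite !unbump_gt // ltn_neqAle eq_sym kj1.
  by rewrite face_conn_eq0 // face_degen_eq0 // zP // subr0 addr0.
Qed.

Lemma fill_gt m i a j b (y : G m.+1) : (i < j < m.+2)%N ->
  (forall k e, (i < k < j)%N -> D (unbump j k) e y = 0) ->
  D (unbump j i) (~~ a) y = 0 -> fills i a j b y.
Proof.
move def_d: (j - i.+1)%N => d; elim: d j b def_d => [|d IHd] j b def_d.
  move=> /andP[ltij ltj] _.
  have def_j : j = i.+1.
    by apply/eqP; rewrite eqn_leq ltij -subn_eq0 def_d.
  rewrite unbump_lt // => y0; apply: fills_false => //.
  rewrite {}def_j in ltij ltj *.
  have aux k e : k != i -> k != i.+1 -> D (unbump i.+1 k) e y = 0 ->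
      D (unbump i k) e y = 0.
    case: (ltngtP k i) => // [h|h] _ ki1.
      by rewrite !unbump_lt // (ltn_trans h).
    by rewrite !unbump_gt // ltn_neqAle eq_sym ki1.
  case: a y0 => /= y0.
    exists (C i y - S i y); split; rewrite ?raddfB /=.
    - rewrite face0_conn_id //; last by right.
      by rewrite face_degen_eq0 ?subr0 //; [exact: ltnW|rewrite neq_ltn leqnn orbT|rewrite unbump_gt].
    - rewrite (face1_conn CP) //; last by right.
      rewrite (face_degen_gt GP) ?leqnn //=.
      by rewrite subrr.
    - move=> k e ltk kj; case: (eqVneq k i) => [->|ki] ke yk; rewrite raddfB /=.
        case: e ke yk => [|_ yk]; first by rewrite eqxx.
        by rewrite face0_conn_id ?face_degen_id ?subrr //; [exact: ltnW|left].
      have yk' := aux _ _ ki kj yk.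
      by rewrite face_conn_eq0 // face_degen_eq0 ?subrr //; exact: ltnW.
  exists (C i y); split.
  - by rewrite face0_conn_id //; right.
  - by rewrite face1_conn_eq0 //; right.
  - move=> k e ltk kj; case: (eqVneq k i) => [->|ki] ke yk.
      case: e ke yk => [_ yk|]; last by rewrite eqxx.
      by rewrite face1_conn_eq0 //; left.
    by rewrite face_conn_eq0 // aux.
case: j def_d => // j def_d /andP[ltij ltj] y0 yi.
have {}ltij : (i < j)%N by rewrite -subn_gt0 -subSS def_d.
have yj e : D j e y = 0.
  by have := y0 j e; rewrite unbump_lt // ltij leqnn => ->.
have [||k e /andP[h1 h2]||z [z1 z2 zP]] := IHd j true.
- by move: def_d; rewrite subSS subnS => ->.
- by rewrite ltij ltnW.
- have h3 : (k < j.+1)%N := ltnW h2.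
  by have := y0 k e; rewrite !unbump_lt // h1 h3; apply.
- by move: yi; rewrite !unbump_lt // ltnW.
apply: fills_false => //.
have zj e : D j.+1 e z = 0.
  apply: zP => //; first by rewrite neq_ltn leqnn orbT.
    by rewrite xpair_eqE gtn_eqF // ltnW.
  by rewrite unbump_gt.
have sj e : D j.+1 e (S j y) = 0.
  rewrite face_degen_eq0 ?unbump_gt //; first exact: ltnW.
  by rewrite neq_ltn leqnn orbT.
exists (C j y - S j y + z); split; rewrite ?(raddfD, raddfN) /= ?(raddfD, raddfN) /=.
- by rewrite face0_conn_id ?sj ?zj ?subr0 ?addr0 //; right.
- by rewrite face1_conn_eq0 ?sj ?zj ?subr0 ?addr0 //; right.
- move=> k e ltk kj1 ke yk; rewrite !(raddfD, raddfN) /=.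
  case: (eqVneq k j) => [->|kj].
    rewrite face_degen_id ?(ltnW ltj) //; case: e {ke yk}.
      by rewrite face1_conn_eq0 ?z1 ?sub0r ?addNr //; left.
    by rewrite face0_conn_id ?z2 ?subrr ?addr0 //; left.
  have yk' : D (unbump j k) e y = 0.
    move: yk; case: (ltngtP k j) kj => // [h|h] _.
      by rewrite !unbump_lt // (ltn_trans h).
    by rewrite !unbump_gt // ltn_neqAle eq_sym kj1.
  by rewrite face_conn_eq0 // face_degen_eq0 ?(ltnW ltj) // zP // subr0 addr0.
Qed.

Section Box.
Variables (m i : nat) (a : bool).
Hypothesis lti : (i < m.+2)%N.

Definition nat_box (x : nat -> bool -> G m.+1) := forall j k e w,
  (j < k < m.+2)%N -> (j, e) != (i, a) -> (k, w) != (i, a) ->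
  D j e (x k w) = D k.-1 w (x j e).

Definition agree (K : pred nat) (x : nat -> bool -> G m.+1) (z : G m.+2) :=
  forall k e, (k < m.+2)%N -> K k -> (k, e) != (i, a) -> D k e z = x k e.

Lemma nat_box_unbump x j k e w : nat_box x -> (j < m.+2)%N -> (k < m.+2)%N ->
  j != k -> (j, e) != (i, a) -> (k, w) != (i, a) ->
  D (unbump k j) e (x k w) = D (unbump j k) w (x j e).
Proof.
move=> xP ltj ltk; case: (ltngtP j k) => // h _ je kw.
  by rewrite unbump_lt // unbump_gt // xP // h.
by rewrite unbump_gt // unbump_lt // -xP // h.
Qed.

Lemma agree_zero K x j : nat_box x -> agree K x 0 -> (j < m.+2)%N -> j != i ->
  ~~ K j -> K i -> (forall k, (j < k < i)%N || (i < k < j)%N -> K k) ->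
  exists z, agree (fun k => K k || (k == j)) x z.
Proof.
move=> xP x0 ltj ji Kj Ki Kb.
have je b : (j, b) != (i, a) by rewrite xpair_eqE (negbTE ji).
have y0 k e b : (k < m.+2)%N -> K k -> (k, e) != (i, a) ->
    D (unbump j k) e (x j b) = 0.
  move=> ltk Kk ke.
  have kj : k != j by apply: contraNneq Kj => <-.
  by rewrite nat_box_unbump // -x0 // !raddf0.
have ia : (i, ~~ a) != (i, a) by rewrite xpair_eqE eqxx; case: (a).
have fillP b : fills i a j b (x j b).
  move: ji; rewrite neq_ltn => /orP[h|h].
    apply: fill_lt; rewrite ?h ?y0 // => k e /andP[h1 h2].
    rewrite y0 ?(ltn_trans h2) ?Kb ?h1 ?h2 //.
    by rewrite xpair_eqE (ltn_eqF h2).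
  apply: fill_gt; rewrite ?h ?y0 // => k e /andP[h1 h2].
  rewrite y0 ?(ltn_trans h2) ?Kb ?h1 ?h2 ?orbT //.
  by rewrite xpair_eqE (gtn_eqF h1).
have [zf [zf1 zf2 zfP]] := fillP false.
have [zt [zt1 zt2 ztP]] := fillP true.
exists (zf + zt) => k e ltk Kk ke; rewrite raddfD /=.
case: (eqVneq k j) Kk => [->|kj] /=.
  by move=> _; case: e {ke}; rewrite ?zf1 ?zt1 ?zf2 ?zt2 ?addr0 ?add0r.
rewrite orbF => Kk.
by rewrite zfP ?ztP ?y0 // addr0 -x0 // raddf0.
Qed.

Lemma agree_step K x j : nat_box x -> (j < m.+2)%N -> j != i ->
  ~~ K j -> K i -> (forall k, (j < k < i)%N || (i < k < j)%N -> K k) ->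
  (exists z, agree K x z) -> exists z, agree (fun k => K k || (k == j)) x z.
Proof.
move=> xP ltj ji Kj Ki Kb [z zP].
pose x' k e := x k e - D k e z.
have x'P : nat_box x'.
  move=> p q e w /andP[ltpq ltq] pe qw; rewrite /x' !raddfB /=.
  by rewrite xP ?ltpq // (face_face GP) ?ltpq.
have x'0 : agree K x' 0.
  by move=> k e ltk Kk ke; rewrite raddf0 /x' zP // subrr.
have [z' z'P] := agree_zero x'P x'0 ltj ji Kj Ki Kb.
exists (z + z') => k e ltk Kk ke.
by rewrite raddfD /= z'P // /x' addrC subrK.
Qed.

Lemma agree_sub (K K' : pred nat) x :
  (forall k, (k < m.+2)%N -> K' k -> K k) ->
  (exists z, agree K x z) -> exists z, agree K' x z.
Proof.
by move=> sub [z zP]; exists z => k e ltk Kk ke; apply: zP => //; apply: sub.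
Qed.

Lemma nat_box_fill x : nat_box x -> exists z, agree predT x z.
Proof.
move=> xP.
have right r : (i + r < m.+2)%N ->
    exists z, agree (fun k => i <= k <= i + r)%N x z.
  elim: r => [|r IHr] ltr.
    exists (S i (x i (~~ a))) => k e ltk.
    rewrite addn0 -eqn_leq => /eqP <-; rewrite xpair_eqE eqxx /= => ea.
    by rewrite face_degen_id //; congr x; case: (a) (e) ea => [] [].
  rewrite addnS in ltr.
  apply: agree_sub (agree_step xP ltr _ _ _ _ (IHr (ltnW ltr))).
  - by move=> k ltk /andP[ik]; rewrite ik leq_eqVlt addnS ltnS orbC.
  - by rewrite gtn_eqF // ltnS leq_addr.
  - by rewrite ltnn andbF.
  - by rewrite leqnn leq_addr.
  - move=> k /orP[] /andP[h1 h2]; last by rewrite ltnW.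
    by have := leq_ltn_trans (leq_addr r i) (ltnW (ltn_trans h1 h2)); rewrite ltnn.
have left l : (l <= i)%N -> exists z, agree (fun k => i - l <= k)%N x z.
  elim: l => [|l IHl] ltl.
    apply: agree_sub (right (m.+1 - i)%N _) => [k ltk|]; rewrite ?subn0.
      by move=> ->; rewrite subnKC.
    by rewrite subnKC.
  have lt1 : (i - l.+1 < i)%N by rewrite ltn_subrL; case: (i) ltl.
  have eq1 : (i - l = (i - l.+1).+1)%N by rewrite subnSK.
  apply: agree_sub (agree_step xP (ltn_trans lt1 lti) _ _ _ _ (IHl (ltnW ltl))).
  - by move=> k ltk; rewrite eq1 leq_eqVlt orbC eq_sym.
  - by rewrite ltn_eqF.
  - by rewrite eq1 ltnn.
  - exact: leq_subr.
  - move=> k /orP[] /andP[h1 h2]; first by rewrite eq1.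
    by rewrite (leq_trans (leq_subr _ _)) // ltnW.
have [z zP] := left i (leqnn i).
by exists z => k e ltk _ ke; apply: zP => //; rewrite subnn.
Qed.

End Box.

Definition cubicalSet_of : cubicalSet := @CubicalSet (fun n => G n : choiceType)
  (fun n i a => gface i a) (fun n i => gdegen i) GP.

(* Tonks's theorem for cubical abelian groups with connections. *)
Theorem kan_cubicalAbGroup : kan cubicalSet_of.
Proof.
move=> [|m] i a x.
  move=> _; exists (S 0 (x ord0 (~~ a))) => j e; rewrite (ord1 i) (ord1 j).
  rewrite xpair_eqE eqxx /= => ea; transitivity (x ord0 (~~ a)).
    by have := face_degen_id e (x ord0 (~~ a)) (ltn0Sn 0); rewrite inord0E.
  by congr x; case: (a) (e) ea => [] [].
move=> /= xP; pose y k e : G m.+1 := x (inord k) e.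
have iE k e : (k < m.+2)%N -> ((inord k, e) == (i, a)) = ((k, e) == (val i, a)).
  by move=> ltk; rewrite !xpair_eqE -val_eqE /= inordK.
have yP : nat_box i a y.
  move=> j k e w /andP[ltjk ltk] je kw.
  have ltj := ltn_trans ltjk ltk.
  by have := xP (inord j) (inord k) e w; rewrite !iE // !inordK //; apply.
have [z zP] := nat_box_fill (ltn_ord i) yP.
exists z => j e je; have := zP j e (ltn_ord j) isT.
by rewrite /y inord_val; apply.
Qed.

Definition pointedKan_of : pointedKan :=
  PointedKan kan_cubicalAbGroup (0 : G 0%N).

End Tonks.

Section PiOfGroup.
Variable G : cubicalAbGroup.

Definition piG n := homotopyGroup (pointedKan_of G) n.

Definition piG0_add (a b : piG 0) : piG 0 :=
  \pi_(piG 0) (exist _ (val (repr a) + val (repr b) : G 0%N) isT).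

Lemma piG0_addE (x y w : sphere (pointedKan_of G) 0) :
  val w = (val x : G 0%N) + (val y : G 0%N) ->
  piG0_add (\pi_(piG 0) x) (\pi_(piG 0) y) = \pi_(piG 0) w.
Proof.
move=> wE; apply/homotopyGroupP; rewrite wE /=.
have hr (u : sphere (pointedKan_of G) 0) :
    homotopic (val (repr (\pi_(piG 0) u))) (val u).
  by apply/homotopyGroupP; rewrite reprK.
have [u [u0 u1 _]] := hr x; have [v [v0 v1 _]] := hr y.
exists ((u : G 1%N) + (v : G 1%N)); split=> [||j e]; last by rewrite (ord1 j).
- by rewrite -u0 -v0 /= raddfD.
- by rewrite -u1 -v1 /= raddfD.
Qed.

Definition piG_op n : piG n -> piG n -> piG n :=
  match n with
  | 0 => piG0_add
  | m.+1 => @homotopy_mul (pointedKan_of G) m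
  end.

End PiOfGroup.

Section PiOfHom.
Variables (G H : cubicalAbGroup) (f : cubicalAbHom G H).

Definition pointedMap_of : pointedMap (pointedKan_of G) (pointedKan_of H) :=
  @PointedMap (pointedKan_of G) (pointedKan_of H) (fun n => f n)
    (ghom_face f) (ghom_degen f) (raddf0 (f 0%N)).

Definition piG_map n : piG G n -> piG H n := @homotopy_map _ _ pointedMap_of n.

End PiOfHom.

Record chainComplex := ChainComplex {
  chain :> nat -> zmodType;
  bound : forall n, {additive chain n.+1 -> chain n};
  bound_bound : forall n (x : chain n.+2), bound n (bound n.+1 x) = 0
}.

Record chainMap (A B : chainComplex) := ChainMap {
  chmap :> forall n, {additive A n -> B n};
  chmap_bound : forall n (x : A n.+1), chmap n (bound A n x) = bound B n (chmap n.+1 x)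
}.

Section Homology.
Variable A : chainComplex.

Definition cycle_pred n : {pred A n} :=
  match n with
  | 0 => predT
  | m.+1 => [pred x | bound A m x == 0]
  end.

Lemma cycle_zmod_closed n : zmod_closed (@cycle_pred n).
Proof.
case: n => [|n]; split=> // [|x y]; rewrite !inE ?raddf0 // raddfB.
by move=> /eqP-> /eqP->; rewrite subrr.
Qed.

HB.instance Definition _ n :=
  GRing.isZmodClosed.Build (A n) (@cycle_pred n) (@cycle_zmod_closed n).

Record cycle n := Cycle { cycle_val : A n; _ : cycle_val \in @cycle_pred n }.

HB.instance Definition _ n := [isSub for @cycle_val n].
HB.instance Definition _ n := [Choice of cycle n by <:].
HB.instance Definition _ n := [SubChoice_isSubZmodule of cycle n by <:].

Definition boundary_pred n : {pred cycle n} :=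
  [pred x : cycle n | `[< exists y : A n.+1, bound A n y = val x >]].

Lemma boundary_zmod_closed n : zmod_closed (@boundary_pred n).
Proof.
split=> [|x y]; first by apply/asboolP; exists 0; rewrite !raddf0.
move=> /asboolP[u ux] /asboolP[v vy]; apply/asboolP; exists (u - v).
by rewrite !raddfB /= ux vy.
Qed.

HB.instance Definition _ n :=
  GRing.isZmodClosed.Build (cycle n) (@boundary_pred n) (@boundary_zmod_closed n).

Definition homology n : zmodType := Quotient.quot (@boundary_pred n).

End Homology.

Section HomologyMap.
Variables (A B : chainComplex) (f : chainMap A B).

Lemma chmap_cycle n (x : cycle A n) : f n (val x) \in @cycle_pred B n.
Proof.
case: n x => // n x; rewrite inE -chmap_bound.
by have := valP x; rewrite inE => /eqP->; rewrite raddf0.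
Qed.

Definition cycle_map n (x : cycle A n) : cycle B n := Cycle (chmap_cycle x).

Definition homology_map n (c : homology A n) : homology B n :=
  \pi_(homology B n) (cycle_map (repr c)).

Lemma homology_mapE n (x : cycle A n) :
  homology_map (\pi_(homology A n) x) = \pi_(homology B n) (cycle_map x).
Proof.
apply/eqP; rewrite -Quotient.idealrBE; apply/asboolP.
have /eqP := reprK (\pi_(homology A n) x).
rewrite -Quotient.idealrBE => /asboolP[y yE].
by exists (f n.+1 y); rewrite -chmap_bound yE !raddfB.
Qed.

End HomologyMap.

Section NormalizedComplex.
Variable G : cubicalAbGroup.

Definition normal_pred n : {pred G n} :=
  match n with
  | 0 => predT
  | m.+1 => [pred x : G m.+1 | [forall i, gface i true x == 0]]
  end.

Lemma normalP n (x : G n.+1) :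
  reflect (forall i, gface i true x = 0) (x \in @normal_pred n.+1).
Proof. by rewrite inE; apply: (iffP forallP) => h i; apply/eqP; apply: h. Qed.

Lemma normal_zmod_closed n : zmod_closed (@normal_pred n).
Proof.
case: n => [|n]; split=> //; first by apply/normalP => i; rewrite raddf0.
move=> x y /normalP x0 /normalP y0; apply/normalP => i.
by rewrite raddfB /= x0 y0 subrr.
Qed.

HB.instance Definition _ n :=
  GRing.isZmodClosed.Build (G n) (@normal_pred n) (@normal_zmod_closed n).

Record normal n := Normal { normal_val : G n; _ : normal_val \in @normal_pred n }.

HB.instance Definition _ n := [isSub for @normal_val n].
HB.instance Definition _ n := [Choice of normal n by <:].
HB.instance Definition _ n := [SubChoice_isSubZmodule of normal n by <:].

Definition alt_face n (x : G n.+1) : G n :=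
  \sum_(i < n.+1) gface i false x *~ (-1) ^+ i.

Lemma alt_face_normal n (x : normal n.+1) :
  alt_face (val x) \in @normal_pred n.
Proof.
case: n x => // n x; apply/normalP => j; have /normalP x0 := valP x.
rewrite raddf_sum big1 // => i _; rewrite raddfMz /=.
suff -> : gface j true (gface i false (val x)) = 0 by rewrite mul0rz.
case: (ltnP j i) => ij.
  have := face_face (gcubicalP G) true false (val x) (i := j) (j := i).
  by rewrite !inord_val ltn_ord andbT => -> //; rewrite x0 raddf0.
have := face_face (gcubicalP G) false true (val x) (i := i) (j := j.+1).
rewrite ltnS ij ltnS ltn_ord /= inord_val => /(_ isT).
by rewrite x0 raddf0 inord_val => <-.
Qed.

Definition normal_bound n (x : normal n.+1) : normal n :=
  Normal (alt_face_normal x).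

Lemma normal_bound_zmod_morphism n : zmod_morphism (@normal_bound n).
Proof.
move=> x y; apply: val_inj; rewrite /= /alt_face -sumrB.
by apply: eq_bigr => i _; rewrite -mulrzBl -raddfB.
Qed.

HB.instance Definition _ n := GRing.isZmodMorphism.Build
  (normal n.+1) (normal n) (@normal_bound n) (@normal_bound_zmod_morphism n).

Lemma alt_face_alt_face n (x : G n.+2) : alt_face (alt_face x) = 0.
Proof.
pose F (p : 'I_n.+2 * 'I_n.+1) : G n :=
  gface p.2 false (gface p.1 false x) *~ ((-1) ^+ p.1 * (-1) ^+ p.2).
have -> : alt_face (alt_face x) = \sum_p F p.
  have -> : \sum_p F p = \sum_j \sum_i F (j, i) by rewrite pair_bigA.
  rewrite exchange_big /alt_face; apply: eq_bigr => i _.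
  rewrite raddf_sum mulrz_suml; apply: eq_bigr => j _.
  by rewrite raddfMz /F -mulrzA.
rewrite (bigID (fun p : 'I_n.+2 * 'I_n.+1 => p.2 < p.1)%N) /=.
apply/eqP; rewrite addrC addr_eq0 -sumrN; apply/eqP.
pose h (p : 'I_n.+2 * 'I_n.+1) : 'I_n.+2 * 'I_n.+1 := (inord p.2, inord p.1.-1).
pose h' (p : 'I_n.+2 * 'I_n.+1) : 'I_n.+2 * 'I_n.+1 := (inord p.2.+1, inord p.1).
rewrite (reindex_onto h h') => [|[j i] /=]; last first.
  rewrite -leqNgt => ji; have lti : (i < n.+1)%N := ltn_ord i.
  have ltj : (j < n.+1)%N := leq_ltn_trans ji lti.
  by apply/eqP; rewrite xpair_eqE -!val_eqE /= !inordK ?eqxx.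
have predK (j : 'I_n.+2) : (j.-1 < n.+1)%N by case: j => -[|p].
have widK (i : 'I_n.+1) : (i < n.+2)%N := leqW (ltn_ord i).
have hhE (j : 'I_n.+2) (i : 'I_n.+1) : (h' (h (j, i)) == (j, i)) = (0 < j)%N.
  rewrite /h /h' xpair_eqE -!val_eqE /= (inordK (predK j)) (inordK (widK i)).
  rewrite (inordK (ltn_ord i)) (inordK (predK j : j.-1.+1 < n.+2)%N) eqxx andbT.
  by case: j => -[|p] //= _; rewrite eqxx.
have condE (j : 'I_n.+2) (i : 'I_n.+1) :
    ~~ ((h (j, i)).2 < (h (j, i)).1)%N && (h' (h (j, i)) == (j, i)) = (i < j)%N.
  rewrite hhE /= (inordK (predK j)) (inordK (widK i)) -leqNgt.
  by case: j => -[|p] //= _; rewrite ?andbF // andbT.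
apply: eq_big => -[j i]; rewrite condE // => ltij.
have ltij2 : (i < j < n.+2)%N by rewrite ltij ltn_ord.
rewrite /F /= (inordK (predK j)) (inordK (widK i)).
have := face_face (gcubicalP G) false false x ltij2.
rewrite !inord_val => ->; rewrite -mulrNz -!exprD; congr (_ *~ _).
have -> : (j + i = (i + j.-1).+1)%N by case: (val j) ltij => // p _; rewrite addnC addnS.
by rewrite exprS mulN1r opprK.
Qed.

Lemma normal_bound_bound n (x : normal n.+2) : normal_bound (normal_bound x) = 0.
Proof. by apply: val_inj; rewrite /= alt_face_alt_face. Qed.

Definition normalComplex : chainComplex :=
  @ChainComplex (fun n => normal n : zmodType) (fun n => @normal_bound n)
    normal_bound_bound.

End NormalizedComplex.

Section NormalizedMap.
Variables (G H : cubicalAbGroup) (f : cubicalAbHom G H).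

Lemma ghom_normal n (x : normal G n) : f n (val x) \in @normal_pred H n.
Proof.
case: n x => // n x; apply/normalP => i; have /normalP x0 := valP x.
by rewrite -ghom_face x0 raddf0.
Qed.

Definition normal_hom n (x : normal G n) : normal H n := Normal (ghom_normal x).

Lemma normal_hom_zmod_morphism n : zmod_morphism (@normal_hom n).
Proof. by move=> x y; apply: val_inj; rewrite /= raddfB. Qed.

HB.instance Definition _ n := GRing.isZmodMorphism.Build
  (normal G n) (normal H n) (@normal_hom n) (@normal_hom_zmod_morphism n).

Lemma normal_hom_bound n (x : normal G n.+1) :
  normal_hom (normal_bound x) = normal_bound (normal_hom x).
Proof.
apply: val_inj; rewrite /= /alt_face raddf_sum; apply: eq_bigr => i _.
by rewrite raddfMz /= ghom_face.
Qed.

Definition normalMap : chainMap (normalComplex G) (normalComplex H) :=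
  @ChainMap (normalComplex G) (normalComplex H) (fun n => @normal_hom n)
    normal_hom_bound.

End NormalizedMap.

(* Main.v *)
(* On N(G) the faces d_i^0 together with the connections, used as            *)
(* degeneracies, satisfy the simplicial identities up to a shift of the       *)
(* degree by one.  So, as in the Dold-Kan correspondence, the inclusion of    *)
(* the Moore subcomplex (all faces zero except the first d^0) is a homology   *)
(* isomorphism: the last nonzero face d_t of x is removed by subtracting      *)
(* Gamma_{t-1} d_t x, which up to sign is the homotopy formula                *)
(* d Gamma_t - Gamma_{t-1} d.  The cycles of the Moore complex are exactly    *)
(* the spherical elements, and two of them are homotopic if and only if they  *)
(* differ by a boundary of the Moore complex.                                 *)
From HB Require Import structures.
Require Import Defs.
From mathcomp Require Import all_boot all_order all_algebra.
From mathcomp Require Import boolp.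

Set Implicit Arguments.
Unset Strict Implicit.
Unset Printing Implicit Defensive.

Import GRing.Theory.
Local Open Scope ring_scope.
Local Open Scope quotient_scope.

(** A spherical element is a cycle of N(G), and the isomorphism sends its homotopy class to its
    homology class. Translating by a degeneracy turns a homotopy from x to y into a Moore chain with
    boundary x - y ([homotopicP]). Everything then rests on [truncate]: a normalized chain with
    spherical boundary can be replaced by a Moore chain with the same boundary. Applied to chains
    bounding x - y, this gives injectivity ([homotopic_homologous]); applied to cycles, where the
    change is itself a boundary, it gives surjectivity ([sphere_of_cycle]). An explicit filler shows
    that the product of classes is induced by addition ([sum_filler]). *)

Section Reduction.
Variable G : cubicalAbGroup.
Local Notation D i e x := (gface (inord i) e x).
Local Notation S i x := (gdegen (inord i) x).
Local Notation C i x := (gconn (inord i) x).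
Local Notation X := (pointedKan_of G).

(** * Normalized chains and boundaries of connections *)

Lemma base_group n : base X n = 0 :> G n.
Proof. by elim: n => //= n ->; rewrite raddf0. Qed.

Lemma spherical_group n (x : G n.+1) :
  spherical (X := X) (n := n.+1) x <-> forall j e, gface j e x = 0.
Proof.
split=> [/sphericalP x0 j e|x0].
  by have /= -> := x0 j e; rewrite base_group.
by apply/sphericalP => j e /=; rewrite base_group.
Qed.

Lemma normal_face n (x : G n.+1) k : x \in @normal_pred G n.+1 ->
  D k true x = 0.
Proof. by move=> /Defs.normalP ->. Qed.

Lemma alt_face_zmod_morphism n : zmod_morphism (@alt_face G n).
Proof.
move=> x y; rewrite /alt_face -sumrB.
by apply: eq_bigr => i _; rewrite raddfB mulrzBl.
Qed.

HB.instance Definition _ n := GRing.isZmodMorphism.Build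
  (G n.+1) (G n) (@alt_face G n) (@alt_face_zmod_morphism n).

Lemma alt_faceE n (x : G n.+1) :
  alt_face x = \sum_(0 <= i < n.+1) D i false x *~ (-1) ^+ i.
Proof.
by rewrite big_mkord; apply: eq_bigr => i _; rewrite inord_val.
Qed.

Lemma conn_normal n t (x : G n.+1) : (t < n.+1)%N ->
  x \in @normal_pred G n.+1 -> C t x \in @normal_pred G n.+2.
Proof.
move=> ltt x0; apply/Defs.normalP => k; rewrite -[k]inord_val.
have [->|kt] := eqVneq (val k) t.
  by apply: face1_conn_eq0; rewrite ?normal_face //; left.
have [->|kt1] := eqVneq (val k) t.+1.
  by apply: face1_conn_eq0; rewrite ?normal_face //; right.
by apply: face_conn_eq0; rewrite ?normal_face.
Qed.

Lemma alt_face_in_normal n (x : G n.+1) :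
  x \in @normal_pred G n.+1 -> alt_face x \in @normal_pred G n.
Proof. by move=> xN; have := alt_face_normal (Normal xN). Qed.

(* The two faces of [C t x] equal to [x] carry opposite signs. *)
Lemma alt_face_conn n t (x : G n.+1) : (t < n.+1)%N ->
  alt_face (C t x) =
    \sum_(0 <= i < t) D i false (C t x) *~ (-1) ^+ i
    + \sum_(t.+2 <= i < n.+2) D i false (C t x) *~ (-1) ^+ i.
Proof.
move=> ltt; rewrite alt_faceE (big_cat_nat (n := t)) //=;
  last exact: leqW (ltnW ltt).
congr (_ + _); rewrite big_ltn ?(leq_trans ltt) // big_ltn //.
rewrite !face0_conn_id //; [|by right|by left].
by rewrite addrA exprS mulN1r mulrNz subrr add0r.
Qed.

Lemma alt_face_conn_spherical n t (x : G n.+1) : (t < n.+1)%N ->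
  (forall j e, gface j e x = 0) -> alt_face (C t x) = 0.
Proof.
move=> ltt x0; rewrite alt_face_conn // !big_nat !big1 ?addr0 //.
  move=> k /andP[h1 h2]; rewrite face_conn_eq0 ?mul0rz //.
    by rewrite gtn_eqF // ltnW.
  by rewrite gtn_eqF.
move=> k /andP[h1 h2]; rewrite face_conn_eq0 ?mul0rz //.
- by rewrite (leq_trans h2) // ltnW // ltnW.
- by rewrite ltn_eqF.
- by rewrite ltn_eqF // ltnW.
Qed.

(** * Truncation to the Moore complex *)

(* On [normal] elements, [truncated 0] cuts out the Moore complex. *)
Definition truncated n t (x : G n.+1) :=
  forall i, (t < i < n.+1)%N -> D i false x = 0.

(** The 0-faces of [C u.+1 x] below [u.+1] are [C u] of those of [x], the two at [u.+1] and [u.+2]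
    cancel, and the later ones come from vanishing faces of [x]. *)
Lemma alt_face_conn_truncated n u (x : G n.+2) : (u < n.+1)%N ->
  truncated u.+1 x ->
  alt_face (C u.+1 x) = C u (alt_face x - D u.+1 false x *~ (-1) ^+ u.+1).
Proof.
move=> ltu x0; rewrite alt_face_conn //.
have -> : \sum_(u.+3 <= i < n.+3) D i false (C u.+1 x) *~ (-1) ^+ i = 0.
  rewrite big_nat big1 // => i /andP[h1 h2].
  rewrite (face_conn_gt (gconnP G)) ?h1 // x0 ?raddf0 ?mul0rz //.
  by case: i h1 h2 => // i; rewrite /= !ltnS => -> ->.
have -> : alt_face x = \sum_(0 <= i < u.+1) D i false x *~ (-1) ^+ i
    + D u.+1 false x *~ (-1) ^+ u.+1.
  rewrite alt_faceE (big_cat_nat (n := u.+2)) //=.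
  rewrite big_nat_recr //= [X in _ + X]big_nat [X in _ + X]big1 ?addr0 //.
  by move=> i hi; rewrite x0 ?mul0rz.
rewrite addr0 addrK raddf_sum !big_nat; apply: eq_bigr => i /= ltiu.
by rewrite raddfMz /= (face_conn_lt (gconnP G)) ?ltiu.
Qed.

(** Subtracting [C u (D u.+1 false x)] kills face [u.+1] and keeps the higher ones zero. Up to sign,
    this correction is [C u (alt_face x)] minus a boundary; the first term is a cycle because
    [alt_face x] is spherical, and it vanishes when [x] is a cycle. *)
Lemma truncate_step n u (x : G n.+2) : (u < n.+1)%N ->
  x \in @normal_pred G n.+2 -> truncated u.+1 x ->
  (forall j e, gface j e (alt_face x) = 0) ->
  exists w : G n.+2,
    [/\ w \in @normal_pred G n.+2, truncated u w, alt_face w = alt_face x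
      & alt_face x = 0 ->
        exists2 y, y \in @normal_pred G n.+3 & alt_face y = x - w].
Proof.
move=> ltu xN xt xs.
have sgnK (a : G n.+2) : a *~ (-1) ^+ u.+1 *~ (-1) ^+ u.+1 = a.
  by rewrite -mulrzA -expr2 sqrr_sign.
have hC := alt_face_conn_truncated ltu xt.
pose c := C u (D u.+1 false x).
have cE : c = (C u (alt_face x) - alt_face (C u.+1 x)) *~ (-1) ^+ u.+1.
  by rewrite hC raddfB opprB addrCA subrr addr0 raddfMz /= sgnK.
have CuN : C u.+1 x \in @normal_pred G n.+3 by apply: conn_normal.
have cN : c \in @normal_pred G n.+2.
  rewrite cE rpredMz // rpredB //; last exact: alt_face_in_normal.
  by apply: conn_normal => //; exact: alt_face_in_normal.
exists (x - c); split; first exact: rpredB.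
- move=> i /andP[h1 h2]; rewrite raddfB /=.
  have [ei|ni] := eqVneq i u.+1.
    by rewrite ei face0_conn_id ?subrr //; right.
  have h3 : (u.+1 < i)%N by rewrite ltn_neqAle eq_sym ni.
  rewrite /c xt ?h3 // sub0r face_conn_eq0 ?oppr0 // ?(gtn_eqF (ltnW h3)) //.
  (* Here d_{i-1} d_{u+1} x = d_{u+1} d_i x, and d_i x = 0. *)
  rewrite unbump_gt 1?ltnW //.
  have := face_face (gcubicalP G) false false x (i := u.+1) (j := i).
  by rewrite h3 h2 => /(_ isT) /= <-; rewrite xt ?h3 // raddf0.
- rewrite raddfB /= cE raddfMz raddfB /= alt_face_alt_face subr0.
  by rewrite alt_face_conn_spherical // mul0rz subr0.
(* When [alt_face x = 0], [cE] exhibits [c] as the boundary of this element. *)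
- move=> dx; exists (- C u.+1 x *~ (-1) ^+ u.+1).
    by rewrite rpredMz // rpredN.
  by rewrite raddfMz raddfN /= subKr cE dx raddf0 sub0r.
Qed.

Lemma truncate n t (x : G n.+1) : (t <= n)%N ->
  x \in @normal_pred G n.+1 -> truncated t x ->
  spherical (X := X) (n := n) (alt_face x) ->
  exists w : G n.+1,
    [/\ w \in @normal_pred G n.+1, truncated 0 w, alt_face w = alt_face x
      & alt_face x = 0 ->
        exists2 y, y \in @normal_pred G n.+2 & alt_face y = x - w].
Proof.
elim: t x => [|u IHu] x.
  move=> _ xN x0 _; exists x; split=> // _; exists 0; first exact: rpred0.
  by rewrite subrr raddf0.
case: n x IHu => // n x IHu ltu xN xt xs.
have [|v [vN vt dv vx]] := truncate_step ltu xN xt.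
  exact/spherical_group.
have [|w [wN wt dw wv]] := IHu v (ltnW ltu) vN vt; first by rewrite dv.
exists w; split; rewrite ?dw // => dx.
have [y1 y1N y1E] := vx dx.
have [|y2 y2N y2E] := wv; first by rewrite dv.
by exists (y1 + y2); rewrite ?rpredD // raddfD /= y1E y2E addrA subrK.
Qed.

(** * Spheres as Moore cycles, homotopies as Moore chains *)

Lemma truncated0P n (x : G n.+1) : x \in @normal_pred G n.+1 -> truncated 0 x ->
  forall j e, (j, e) != (ord0, false) -> gface j e x = 0.
Proof.
move=> xN x0 j [] je; first by rewrite -[j]inord_val normal_face.
rewrite -[j]inord_val x0 // ltn_ord andbT -ord_neq0.
by apply: contraNneq je => ->.
Qed.

Lemma alt_face_ord0 n (x : G n.+1) :
  (forall j, j != ord0 -> gface j false x = 0) ->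
  alt_face x = gface ord0 false x.
Proof.
move=> x0; rewrite /alt_face big_ord_recl /= big1 ?addr0 // => i _.
by rewrite x0 ?mul0rz.
Qed.

Lemma spherical_zmod_closed n :
  zmod_closed (@spherical X n : {pred G n}).
Proof.
case: n => [|n]; split=> // [|x y]; rewrite -!topredE /=.
  by apply/spherical_group => j e; rewrite raddf0.
move=> /spherical_group x0 /spherical_group y0; apply/spherical_group => j e.
by rewrite raddfB /= x0 y0 subrr.
Qed.

HB.instance Definition _ n := GRing.isZmodClosed.Build
  (G n) (@spherical X n : {pred G n}) (@spherical_zmod_closed n).

Lemma sphere_normal n (x : sphere X n) : val x \in @normal_pred G n.
Proof.
case: n x => // n x; apply/Defs.normalP => j.
by have /spherical_group -> := valP x.
Qed.

Lemma sphere_cycle n (x : sphere X n) :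
  Normal (sphere_normal x) \in @cycle_pred (normalComplex G) n.
Proof.
case: n x => // n x; rewrite inE; apply/eqP/val_inj.
rewrite /= /alt_face big1 //.
by move=> j _; have /spherical_group -> := valP x; rewrite mul0rz.
Qed.

Definition cycle_of_sphere n (x : sphere X n) :
    Defs.cycle (normalComplex G) n :=
  Cycle (sphere_cycle x).

Lemma homologyP n (x y : Defs.cycle (normalComplex G) n) :
  \pi_(homology (normalComplex G) n) x = \pi_(homology (normalComplex G) n) y
  <-> exists2 z, z \in @normal_pred G n.+1
        & alt_face z = val (val x) - val (val y).
Proof.
split=> [/eqP|[z zN zE]].
  rewrite -Quotient.idealrBE => /asboolP[z zE].
  by exists (val z); [exact: valP | have /(congr1 val) := zE].
apply/eqP; rewrite -Quotient.idealrBE; apply/asboolP.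
by exists (Normal zN); apply: val_inj.
Qed.

(** Translation by the first degeneracy of [y] moves the end [y] of a homotopy to 0 and leaves the
    faces in all other directions unchanged. *)
Lemma homotopicP n (x y : sphere X n) :
  homotopic (X := X) (n := n) (val x) (val y) <->
  exists z : G n.+1, [/\ z \in @normal_pred G n.+1, truncated 0 z
    & gface ord0 false z = val x - val y].
Proof.
have idf m e (a : G m) : gface ord0 e (gdegen ord0 a) = a.
  by rewrite -!inord0E; apply: face_degen_id.
have fd0 j e : j != ord0 -> gface j e (gdegen ord0 (val y : G n)) = 0.
  rewrite ord_neq0 => j0.
  by have := face_degen0 (X := X) (n := n) y e j0; rewrite base_group.
split=> [[z [/= z0 z1 zj]]|[z [zN zt z0]]].
  exists (z - gdegen ord0 (val y : G n)); split.
  - apply/Defs.normalP => j; rewrite raddfB /=.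
    have [->|j0] := eqVneq j ord0; first by rewrite z1 idf subrr.
    by rewrite zj // base_group fd0 // subrr.
  - move=> i /andP[h1 h2]; have i0 : (inord i : 'I_n.+1) != ord0.
      by rewrite ord_neq0 inordK.
    by rewrite raddfB /= zj // base_group fd0 // subrr.
  - by rewrite raddfB /= z0 idf.
have zj := truncated0P zN zt.
exists (z + gdegen ord0 (val y : G n)); split=> /=.
- by rewrite raddfD /= z0 idf subrK.
- by rewrite raddfD /= zj // idf add0r.
- move=> j e j0; rewrite raddfD /= fd0 // base_group zj ?addr0 //.
  by rewrite xpair_eqE (negbTE j0).
Qed.

Lemma homotopic_homologous n (x y : sphere X n) :
  \pi_(piG G n) x = \pi_(piG G n) y <->
  \pi_(homology (normalComplex G) n) (cycle_of_sphere x)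
  = \pi_(homology (normalComplex G) n) (cycle_of_sphere y).
Proof.
split.
  move=> /homotopyGroupP/homotopicP[z [zN zt z0]]; apply/homologyP.
  exists z => //; rewrite alt_face_ord0 // => j j0; apply: truncated0P => //.
  by rewrite xpair_eqE (negbTE j0).
move=> /homologyP[z zN zE]; apply/homotopyGroupP/homotopicP.
(* Being [truncated n] is vacuous in degree [n.+1], and the boundary x - y of [z] is spherical. *)
have [||w [wN wt dw _]] := truncate (leqnn n) zN.
- by move=> i /andP[h1]; rewrite ltnS leqNgt h1.
- by rewrite zE; apply: (rpredB (valP x) (valP y)).
exists w; split=> //; rewrite -zE -dw alt_face_ord0 // => j j0.
by apply: truncated0P => //; rewrite xpair_eqE (negbTE j0).
Qed.

Lemma sphere_of_cycle n (c : Defs.cycle (normalComplex G) n) :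
  exists x : sphere X n,
  \pi_(homology (normalComplex G) n) (cycle_of_sphere x)
  = \pi_(homology (normalComplex G) n) c.
Proof.
case: n c => [|n] c.
  exists (exist _ (val (val c)) isT : sphere X 0).
  by congr (\pi_(_) _); do 2!apply: val_inj.
have dc : alt_face (val (val c)) = 0.
  by have := valP c; rewrite inE => /eqP/(congr1 val).
have [||w [wN wt dw wc]] := truncate (leqnn n) (valP (val c)).
- by move=> i /andP[h1]; rewrite ltnS leqNgt h1.
- rewrite dc; case: (n) => // m; apply/spherical_group => j e.
  by rewrite raddf0.
have wj := truncated0P wN wt.
have ws : spherical (X := X) (n := n.+1) w.
  apply/spherical_group => j e.
  have [[-> ->]|] := eqVneq (j, e) (ord0, false); last exact: wj.
  (* The one remaining face of [w] is its whole alternating boundary, hence zero. *)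
  rewrite -alt_face_ord0 ?dw // => k k0.
  by rewrite wj // xpair_eqE (negbTE k0).
exists (exist _ w ws : sphere X n.+1); apply/esym/homologyP.
exact: wc.
Qed.

(** * The product of spheres is their sum *)

Lemma face_degen_spherical n (a : G n.+1) q k e :
    (forall j b, gface j b a = 0) -> (q < n.+2)%N -> (k < n.+2)%N ->
  D k e (S q a) = if k == q then a else 0.
Proof.
move=> a0 ltq ltk; case: eqVneq => [->|kq]; first exact: face_degen_id.
exact: face_degen_eq0.
Qed.

Lemma face_conn_spherical n (a : G n.+1) k e :
    (forall j b, gface j b a = 0) -> (k < n.+2)%N ->
  D k e (C 0 a) = if (k < 2)%N && ~~ e then a else 0.
Proof.
move=> a0 ltk; case: ltnP => [lt2|le2] /=; last first.
  by rewrite face_conn_eq0 // gtn_eqF // ltnW.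
have k01 : k = 0%N \/ k = 1%N by case: k lt2 {ltk} => [|[|]]; auto.
by case: e; [rewrite face1_conn_eq0 | rewrite face0_conn_id].
Qed.

(** [S 0 x] is a filler for x times 0, and [S 0 y + S 1 y - C 0 y] one for 0 times y: on a spherical
    [y], the latter has the faces of [C 0 y] with the two superscripts exchanged. *)
Lemma sum_filler n (x y : G n.+1) : (forall j e, gface j e x = 0) ->
    (forall j e, gface j e y = 0) ->
  exists2 z : G n.+2, mul_filler (X := X) (n := n) x y z
    & gface ord0 true z = x + y.
Proof.
move=> x0 y0; pose z := S 0 x + S 0 y + S 1 y - C 0 y.
have zF k e : (k < n.+2)%N -> D k e z =
    (if k == 0%N then x else 0) + (if k == 0%N then y else 0)
    + (if k == 1%N then y else 0) - (if (k < 2)%N && ~~ e then y else 0).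
  move=> ltk; rewrite !(raddfB, raddfD) /=.
  by rewrite !face_degen_spherical // face_conn_spherical.
exists z; last by rewrite -inord0E zF //= addr0 subr0.
split=> [|||j e j1]; rewrite ?base_group /=.
- by rewrite -inord0E zF //= addr0 addrK.
- by rewrite zF //= !add0r subrr.
- by rewrite zF //= !add0r subr0.
- rewrite -[j]inord_val zF // (gtn_eqF j1) (gtn_eqF (ltnW j1)) ltnNge j1 /=.
  by rewrite !addr0 subr0.
Qed.

End Reduction.

(** * The natural isomorphism *)

Definition homotopy_to_homology (G : cubicalAbGroup) n (a : piG G n) :
    homology (normalComplex G) n :=
  \pi_(homology (normalComplex G) n) (cycle_of_sphere (repr a)).

Lemma homotopy_to_homologyE (G : cubicalAbGroup) n
    (x : sphere (pointedKan_of G) n) :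
  homotopy_to_homology (\pi_(piG G n) x)
  = \pi_(homology (normalComplex G) n) (cycle_of_sphere x).
Proof. by apply/homotopic_homologous; rewrite reprK. Qed.

Lemma homotopy_to_homology_bij (G : cubicalAbGroup) n :
  bijective (@homotopy_to_homology G n).
Proof.
have inj : injective (@homotopy_to_homology G n).
  by move=> a b /homotopic_homologous; rewrite !reprK.
have surj c : exists a, @homotopy_to_homology G n a = c.
  have [x xc] := sphere_of_cycle (repr c).
  by exists (\pi_(piG G n) x); rewrite homotopy_to_homologyE xc reprK.
have [h hK] := choice surj.
by exists h => // a; apply: inj; rewrite hK.
Qed.

(** In positive degree any filler computes the product, so the one of [sum_filler] may be used. *)
Lemma piG_opE (G : cubicalAbGroup) n (x y : sphere (pointedKan_of G) n) :
  exists2 w : sphere (pointedKan_of G) n,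
    val w = (val x : G n) + (val y : G n)
    & piG_op (\pi_(piG G n) x) (\pi_(piG G n) y) = \pi_(piG G n) w.
Proof.
case: n x y => [|n] x y.
  exists (exist _ ((val x : G 0%N) + (val y : G 0%N)) isT) => //.
  exact: piG0_addE.
have [/spherical_group x0 /spherical_group y0] := (valP x, valP y).
have [z zP zE] := sum_filler x0 y0.
pose w : sphere (pointedKan_of G) n.+1 :=
  exist _ ((val x : G n.+1) + val y) (rpredD (valP x) (valP y)).
exists w => //.
exact: (@homotopy_mulE (pointedKan_of G) n x y w z zP (esym zE)).
Qed.

Lemma homotopy_to_homologyD (G : cubicalAbGroup) n (a b : piG G n) :
  homotopy_to_homology (piG_op a b)
  = homotopy_to_homology a + homotopy_to_homology b.
Proof.
have [w wE opE] := piG_opE (repr a) (repr b).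
rewrite !reprK in opE; rewrite opE homotopy_to_homologyE.
rewrite /homotopy_to_homology -raddfD; congr (\pi_(_) _).
by do 2!apply: val_inj.
Qed.

Lemma homotopy_to_homology_natural (G H : cubicalAbGroup)
    (f : cubicalAbHom G H) n (a : piG G n) :
  homotopy_to_homology (piG_map f a)
  = homology_map (normalMap f) (homotopy_to_homology a).
Proof.
rewrite homology_mapE homotopy_to_homologyE; congr (\pi_(_) _).
by do 2!apply: val_inj.
Qed.

Theorem corollary2p9 :
  exists phi : forall (G : cubicalAbGroup) (n : nat),
      piG G n -> homology (normalComplex G) n,
    [/\ forall (G : cubicalAbGroup) (n : nat), bijective (phi G n),
        forall (G : cubicalAbGroup) (n : nat) (a b : piG G n),
          phi G n (piG_op a b) = phi G n a + phi G n b
      & forall (G H : cubicalAbGroup) (f : cubicalAbHom G H) (n : nat)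
          (a : piG G n),
          phi H n (piG_map f a) = homology_map (normalMap f) (phi G n a)].
Proof.
exists @homotopy_to_homology; split.
- exact: homotopy_to_homology_bij.
- exact: homotopy_to_homologyD.
- exact: homotopy_to_homology_natural.
Qed.
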